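(* Let $d\ge1$, let $n=(n_1,\dots,n_d)$, and let $p\in\mathbb{C}[z_1,\dots,z_d]$ have multidegree at most $n$, no zeros in $\mathbb{D}^d$, and no nonconstant common factor with its reflection $\tilde p$ (at multidegree $n$); assume $\tilde p(0)=0$, and let $F=\tilde p/p$ and $f=\frac{1+F}{1-F}=\frac{p+\tilde p}{p-\tilde p}$. Let $v\in\mathbb{C}[z_1,\dots,z_d]$ be a polynomial of multidegree at most $n$ with $v=\tilde v$, $v(0)=0$, such that $p+v$ and $p-av$ have no zeros in $\mathbb{D}^d$ for some $a>0$, and such that $\frac{p+\tilde p+2v}{p-\tilde p}$ belongs to the face $\mathcal{F}(f)$ of $f$ in $PRP_d$. Suppose $p$ vanishes at $\mathbf{1}=(1,\dots,1)$ to order $M$. Let $\mu\in\mathbb{T}$ satisfy $\mu^2=F(\mathbf{1})$, where $F(\mathbf 1)$ is understood as a non-tangential limit, and assume $\mu^2\neq1$. Then the bottom (degree $M$) homogeneous terms $P_M$ and $V_M$ of $p(\mathbf{1}-\zeta)$ and $v(\mathbf{1}-\zeta)$ at $\zeta=0$ satisfy $$V_M=r\mu P_M$$ for some $r\in\mathbb{R}$.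
   Context: $\mathbb{D}$ is the open unit disk, $\mathbb{T}$ the unit circle, $RHP$ the open right half plane. $PRP_d$ is the convex set of holomorphic functions $f:\mathbb{D}^d\to RHP$ with $f(0)=1$. For an element $x$ of a convex set $S$, the face $\mathcal{F}(x)$ is the union of all line segments $L\subset S$ having $x$ in the interior of $L$, with $\mathcal{F}(x)=\{x\}$ if $x$ is extreme. For a polynomial $q$ of multidegree at most $n$, its reflection at multidegree $n$ is $\tilde q(z)=z_1^{n_1}\cdots z_d^{n_d}\overline{q(1/\bar z_1,\dots,1/\bar z_d)}$; all reflections are at the same $n$. (Every element of $\mathcal{F}(f)$ can be written in the form $\frac{p+\tilde p+2v}{p-\tilde p}$ with $v$ having the listed properties; this is a known theorem of McDonald.) $p$ vanishes to order $M$ at $\mathbf{1}$ if $p(\mathbf{1}-\zeta)=\sum_{j\ge M}P_j(\zeta)$ with $P_j$ homogeneous of total degree $j$ and $P_M\ne0$. In this situation $v$ vanishes at least to order $M$ at $\mathbf{1}$, so $v(\mathbf{1}-\zeta)=\sum_{j\ge M}V_j(\zeta)$ with $V_j$ homogeneous of total degree $j$; $V_M=0$ is allowed. The non-tangential limit $F(\mathbf{1})$ is the limit of $F(\mathbf{1}-\zeta)$ as $\zeta\to0$ non-tangentially in $RHP^d$; it exists and is unimodular, and equals $\lim_{r\nearrow1}F(r,\dots,r)$. *)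

(* Defs.v *)
From HB Require Import structures.
From mathcomp Require Import all_boot all_order all_algebra.
From mathcomp Require Import complex.
From mathcomp Require Import mathcomp_extra boolp classical_sets functions reals.
From mathcomp Require Import topology normedtype derive.
(* The notations of mpoly clash with those of MathComp-Analysis. *)
From mathcomp.multinomials Require Import -(notations) mpoly.

Set Implicit Arguments.
Unset Strict Implicit.
Unset Printing Implicit Defensive.

Import Order.TTheory GRing.Theory Num.Theory.
Import numFieldNormedType.Exports.

Local Open Scope classical_set_scope.
Local Open Scope ring_scope.

(* R[i] itself carries no topology; as a numClosedFieldType it inherits the
   norm topology and makes 'rV[Cplx R]_d a normed module (with the sup norm). *)
Definition Cplx (R : realType) : numClosedFieldType := R[i].

Section Convexity.
Variables (K : numDomainType) (V : lmodType K).
Implicit Types (S : set V) (a b x y : V).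

(* For K = Cplx R, [0 <= t <= 1] forces t to be real, so these are the
   usual real line segments. *)
Definition segment a b : set V :=
  [set (1 - t) *: a + t *: b | t in [set t : K | 0 <= t <= 1]].

Definition segment_interior a b : set V :=
  [set (1 - t) *: a + t *: b | t in [set t : K | 0 < t < 1]].

Definition line_segment_through S x a b : Prop :=
  [/\ a <> b, segment a b `<=` S & segment_interior a b x].

Definition extreme S x : Prop :=
  S x /\ forall a b, ~ line_segment_through S x a b.

Definition face S x : set V :=
  [set y | (extreme S x /\ y = x) \/
           exists a b, line_segment_through S x a b /\ segment a b y].

End Convexity.

Section Polydisc.
Variables (R : realType) (d : nat).
Local Notation C := (Cplx R).
Implicit Types (f g : 'rV[C]_d -> C) (p q : mpoly d C) (n : multinom d).

Definition polydisc : set 'rV[C]_d := [set z | forall i, `|z 0 i| < 1].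

(* A function on the polydisc is represented by its extension by 0. *)
Definition on_polydisc f : 'rV[C]_d -> C := patch (fun=> 0) polydisc f.

Definition holomorphic_on_polydisc f : Prop :=
  forall z, polydisc z -> differentiable f z.

Definition PRP : set ('rV[C]_d -> C) :=
  [set f | [/\ f = on_polydisc f, holomorphic_on_polydisc f,
              forall z, polydisc z -> 0 < 'Re (f z) & f 0 = 1]].

Definition peval p (z : 'rV[C]_d) : C := meval (z 0) p.

Definition zero_free_on_polydisc p : Prop :=
  forall z, polydisc z -> peval p z <> 0.

Definition multidegree_le n p : Prop :=
  forall m, m \in msupp p -> forall i, (m i <= n i)%N.

(* The polynomial z^n * conj (p (1 / conj z)), see [peval_reflection]; this is
   meaningful only when [multidegree_le n p], as [mnm_sub] truncates. *)
Definition reflection n p : mpoly d C :=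
  \sum_(m <- msupp p) (mcoeff m p)^* *: mpolyX C (mnm_sub n m).

Definition no_nonconstant_common_factor p q : Prop :=
  forall h a b : mpoly d C, p = h * a -> q = h * b -> exists c, h = mpolyC d c.

(* The degree M homogeneous term of the polynomial p(1 - zeta) in zeta. *)
Definition homog_at1 (M : nat) p : mpoly d C :=
  pihomog mdeg M (comp_mpoly [tuple 1 - mpolyX C (mnm1 i) | i < d] p).

Definition vanishes_at1_to_order p (M : nat) : Prop :=
  (forall j, (j < M)%N -> homog_at1 j p = 0) /\ homog_at1 M p <> 0.

(* |zeta| <= c * dist(zeta, boundary of RHP^d). *)
Definition nontangential_region (c : R) : set 'rV[C]_d :=
  [set zeta | (forall i, 0 < 'Re (zeta 0 i)) /\
              forall i j, `|zeta 0 i| <= (c%:C)%C * 'Re (zeta 0 j)].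

Definition nontangential_limit_at1 f (l : C) : Prop :=
  forall c : R,
    f (const_mx 1 - zeta)
      @[zeta --> within (nontangential_region c) (nbhs (0 : 'rV[C]_d))] --> l.

Lemma peval_reflection n p (z : 'rV[C]_d) :
  multidegree_le n p -> (forall i, z 0 i != 0) ->
  peval (reflection n p) z =
    (\prod_i z 0 i ^+ n i) * (peval p (\row_i (z 0 i)^*^-1))^*.
Proof.
move=> ndeg z_neq0.
rewrite /peval /reflection raddf_sum /= [in RHS]mevalE rmorph_sum /= mulr_sumr.
rewrite big_seq [RHS]big_seq; apply: eq_bigr => m mp.
rewrite mevalZ mevalX rmorphM /= mulrCA; congr (_ * _).
rewrite rmorph_prod -big_split /=; apply: eq_bigr => i _.
rewrite mxE rmorphXn fmorphV /= conjCK mnmBE exprVn.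
by rewrite expfB_cond // (negPf (z_neq0 i)) /= add0n (ndeg _ mp).
Qed.

End Polydisc.

(* Main.v *)
(* Let e > 0 be such that both g = f + h and f - e h lie in PRP, where
   h = 2 v / (p (1 - F)).  Along a ray z = 1 - t zeta with zeta in RHP^d, f tends
   to (1 + mu^2) / (1 - mu^2), which is purely imaginary, and if the terms of v
   of degree < k <= M vanish then t^(M-k) h tends to
   2 V_k(zeta) / ((1 - mu^2) P_M(zeta)).  As f + h and f - e h have positive real
   part, this limit has real part >= 0 and <= 0, so the rational function
   V_k / ((1 - mu^2) P_M) is purely imaginary on RHP^d, hence constant.  For k < M
   comparing degrees gives V_k = 0; for k = M it gives the claim, since
   i (1 - mu^2) is a real multiple of mu. *)
Require Import Defs.
From HB Require Import structures.
From mathcomp Require Import all_boot all_order all_algebra.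
From mathcomp Require Import complex.
From mathcomp Require Import mathcomp_extra boolp classical_sets functions reals.
From mathcomp Require Import topology normedtype derive.
From mathcomp.multinomials Require Import -(notations) mpoly.
From mathcomp Require Import ring.
Import Order.TTheory GRing.Theory Num.Theory.
Import numFieldNormedType.Exports.
Local Open Scope classical_set_scope.
Local Open Scope ring_scope.

Set Implicit Arguments.
Unset Strict Implicit.

(** * Limits as t tends to 0 through positive reals (0 < t forces t to be real) *)

Lemma horner_cvg_at_right (C : numFieldType) (q : {poly C}) :
  q.[t] @[t --> 0^'+] --> q.[0].
Proof.
elim/poly_ind: q => [|q c ih].
  rewrite (_ : horner 0 = cst 0) ?horner0; first exact: cvg_cst.
  by apply/funext => t; rewrite horner0.
rewrite (_ : horner _ = fun t => q.[t] * t + c); last first.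
  by apply/funext => t; rewrite hornerMXaddC.
apply: cvgD; last exact: cvg_cst.
by apply: cvgM => //; exact: cvg_within.
Qed.

(** If the real part of [l] were negative, some [f t] would be closer to [l] than minus that real
    part, and since real parts are bounded by norms it would have negative real part too. *)
Lemma Re_lim_ge0 (C : numClosedFieldType) (T : Type) (F : set_system T)
    {FF : ProperFilter F} (f : T -> C) (l : C) :
  f @ F --> l -> (\forall t \near F, 0 <= 'Re (f t)) -> 0 <= 'Re l.
Proof.
move=> /cvgrPdist_lt fl f_ge0.
rewrite real_leNgt ?real0 ?Creal_Re//; apply/negP => l_lt0.
have e_gt0 : 0 < - 'Re l by rewrite oppr_gt0.
have [t [flt ft_ge0]] := filter_ex (filterI (fl _ e_gt0) f_ge0).
have := le_lt_trans (leif_normC_Re_Creal (l - f t)).1 flt.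
rewrite raddfB /= real_ltr_norml ?rpredB ?Creal_Re// opprK => /andP[].
by rewrite ltrDl oppr_gt0 => /lt_le_trans/(_ ft_ge0); rewrite ltxx.
Qed.

Lemma horner_shift_order (C : comNzRingType) (k : nat) (q : {poly C}) (t : C) :
  (forall j, (j < k)%N -> q`_j = 0) -> q.[t] = (drop_poly k q).[t] * t ^+ k.
Proof.
move=> q0; rewrite -{1}(poly_take_drop k q) hornerD hornerM hornerXn.
rewrite (_ : take_poly k q = 0) ?horner0 ?add0r//.
by apply/polyP => i; rewrite coef_take_poly coef0; case: ifP => // /q0.
Qed.

Lemma horner0_drop_poly (C : nzRingType) (k : nat) (q : {poly C}) :
  (drop_poly k q).[0] = q`_k.
Proof. by rewrite horner_coef0 coef_drop_poly. Qed.

(** On the unit circle conjugation is inversion, which turns (1 + x) / (1 - x) into its negative. *)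
Lemma Re_cayley_unimodular (C : numClosedFieldType) (x : C) :
  `|x| = 1 -> x != 1 -> 'Re ((1 + x) / (1 - x)) = 0.
Proof.
move=> x1 xN1.
have x0 : x != 0 by rewrite -normr_eq0 x1 oner_neq0.
have xc : x^* = x^-1 by rewrite invC_norm x1 expr1n invr1 mul1r.
rewrite ReE rmorphM fmorphV rmorphD rmorphB rmorph1 /= xc.
have ? : 1 - x != 0 by rewrite subr_eq0 eq_sym.
have ? : x - 1 != 0 by rewrite subr_eq0.
by field; do ?[apply/andP; split] => //.
Qed.

(** [P], [V] and [phi] stand for p, v and F along one ray. Multiplying by t^(M-k) makes the possibly
    singular h converge and, this factor being positive, keeps the signs of real parts. *)
Lemma Re_ray_limit_eq0 (C : numClosedFieldType) (P V : {poly C}) (phi : C -> C)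
    (l e : C) (M k : nat) :
  (k <= M)%N -> (forall j, (j < M)%N -> P`_j = 0) -> P`_M != 0 ->
  (forall j, (j < k)%N -> V`_j = 0) ->
  phi t @[t --> 0^'+] --> l -> `|l| = 1 -> l != 1 -> 0 < e ->
  (\forall t \near 0^'+,
     let f := (1 + phi t) / (1 - phi t) in
     let h := V.[t] *+ 2 / (P.[t] * (1 - phi t)) in
     0 < 'Re (f + h) /\ 0 < 'Re (f - e * h)) ->
  'Re (V`_k / ((1 - l) * P`_M)) = 0.
Proof.
move=> kM P0 PM V0 phil l1 lN1 e0 fh.
have l1N0 : 1 - l != 0 by rewrite subr_eq0 eq_sym.
pose G t : C := t ^+ (M - k) * ((1 + phi t) / (1 - phi t)).
pose H t : C := (drop_poly k V).[t] *+ 2 / ((drop_poly M P).[t] * (1 - phi t)).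
(* The power of 0 is 1 if k = M and 0 if k < M; [L] has zero real part in both cases. *)
pose L : C := 0 ^+ (M - k) * ((1 + l) / (1 - l)).
pose W : C := V`_k *+ 2 / (P`_M * (1 - l)).
have cG : G t @[t --> 0^'+] --> L.
  apply: cvgM.
    have := @horner_cvg_at_right C 'X^(M - k); rewrite hornerXn.
    by rewrite (_ : horner _ = fun t => t ^+ (M - k)) //; apply/funext => t;
      rewrite hornerXn.
  apply: cvgM; first by apply: cvgD => //; exact: cvg_cst.
  by apply: cvgV => //; apply: cvgB => //; exact: cvg_cst.
have cH : H t @[t --> 0^'+] --> W.
  apply: cvgM.
    by apply: cvgMn; rewrite -(horner0_drop_poly k V); exact: horner_cvg_at_right.
  apply: cvgV; first by rewrite mulf_neq0.
  apply: cvgM; last by apply: cvgB => //; exact: cvg_cst.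
  by rewrite -(horner0_drop_poly M P); exact: horner_cvg_at_right.
have ReL : 'Re L = 0.
  rewrite /L ReMl ?Re_cayley_unimodular ?mulr0//.
  by rewrite rpredX ?real0.
have pos : \forall t \near 0^'+, 0 <= 'Re (G t + H t) /\ 0 <= 'Re (G t - e * H t).
  have tpos : \forall t \near (0 : C)^'+, 0 < t by exact: withinT.
  apply: filterS2 tpos fh => t t0 /= [fh1 fh2].
  have hE : H t = t ^+ (M - k) * (V.[t] *+ 2 / (P.[t] * (1 - phi t))).
    rewrite /H (horner_shift_order _ V0) (horner_shift_order _ P0).
    have -> : t ^+ M = t ^+ (M - k) * t ^+ k by rewrite -exprD subnK.
    have tk : t ^+ k != 0 by rewrite expf_neq0// gt_eqF.
    have tMk : t ^+ (M - k) != 0 by rewrite expf_neq0// gt_eqF.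
    move: tk tMk; move: (t ^+ k) (t ^+ (M - k)) => a b a0 b0.
    (* With the remaining inverses turned into variables, [field] asks only that the powers of t be
       nonzero. *)
    rewrite !invfM.
    move: (drop_poly k V).[t] (drop_poly M P).[t]^-1 (1 - phi t)^-1 => x y z.
    by field; rewrite a0 b0.
  have tr : t ^+ (M - k) \is Num.real by rewrite rpredX// gtr0_real.
  rewrite hE /G (mulrCA e) -mulrDr -mulrBr !ReMl//.
  by rewrite !mulr_ge0 ?exprn_ge0 ?ltW.
have W_ge0 : 0 <= 'Re W.
  have -> : 'Re W = 'Re (L + W) by rewrite raddfD /= ReL add0r.
  by apply: (Re_lim_ge0 (cvgD cG cH)); apply: filterS pos => t [].
have W_le0 : 'Re W <= 0.
  rewrite -(pmulr_rle0 _ e0) -ReMl ?gtr0_real// -oppr_ge0.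
  have -> : - 'Re (e * W) = 'Re (L - e * W) by rewrite raddfB /= ReL sub0r.
  have ceH : e * H t @[t --> 0^'+] --> e * W by apply: cvgM => //; exact: cvg_cst.
  by apply: (Re_lim_ge0 (cvgB cG ceH)); apply: filterS pos => t [].
have W0 : 'Re W = 0 by apply/le_anti; rewrite W_le0.
have -> : V`_k / ((1 - l) * P`_M) = 2^-1 * W.
  by rewrite /W; field; rewrite PM l1N0.
by rewrite ReMl ?W0 ?mulr0// rpredV realn.
Qed.

(** * Polynomials on positive points, and rational functions with zero real part *)

(** The integers 1, ..., [size q] are more roots than the degree allows. *)
Lemma poly_eq0_pos (C : numDomainType) (q : {poly C}) :
  (forall t, 0 < t -> q.[t] = 0) -> q = 0.
Proof.
move=> q0; apply: (@roots_geq_poly_eq0 _ q [seq i.+1%:R | i <- iota 0 (size q)]).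
- by apply/allP => _ /mapP[i _ ->]; apply/rootP; rewrite q0.
- by rewrite map_inj_uniq ?iota_uniq// => i j /eqP; rewrite eqr_nat => /eqP[].
- by rewrite size_map size_iota.
Qed.

(** Induction on the number of variables: if [m0] occurs in p, collect in [c] the terms with the
    same first exponent as [m0], with the first variable dropped. Then [c] satisfies the hypothesis
    in d variables, yet has the nonzero coefficient of [m0]. *)
Lemma meval_pos_eq0 (C : numDomainType) (d : nat) (p : mpoly d C) :
  (forall x : 'I_d -> C, (forall i, 0 < x i) -> meval x p = 0) -> p = 0.
Proof.
elim: d p => [|d ih] p p0.
  have := p0 (fun=> 1) (fun=> ltr01).
  by rewrite (nvar0_mpolyC p) mevalC => ->; rewrite mpolyC0.
apply/eqP/contraT; rewrite -msupp_eq0.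
case: (boolP (msupp p == [::])) => //; case E : (msupp p) => [//|m0 s] _ _.
have m0p : m0 \in msupp p by rewrite E mem_head.
pose tl (m : multinom d.+1) : multinom d := Multinom [tuple m (lift ord0 i) | i < d].
pose c : mpoly d C :=
  \sum_(m <- msupp p | m ord0 == m0 ord0) mcoeff m p *: mpolyX C (tl m).
have c0 : c = 0.
  apply: ih => x x_gt0.
  (* This is p as a polynomial in its first variable, the others being fixed at [x]; its coefficient
     of degree [m0 ord0] is c(x). *)
  pose q : {poly C} :=
    \sum_(m <- msupp p) (mcoeff m p * meval x (mpolyX C (tl m))) *: 'X^(m ord0).
  have q0 : q = 0.
    apply: poly_eq0_pos => t t_gt0.
    pose y i := if unlift ord0 i is Some j then x j else t.
    rewrite -(p0 y); last by move=> i; rewrite /y; case: unliftP.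
    rewrite mevalE horner_sum; apply: eq_bigr => m _.
    rewrite hornerZ hornerXn big_ord_recl /y unlift_none -mulrA; congr (_ * _).
    rewrite mulrC mevalX; congr (_ * _).
    by apply: eq_bigr => i _; rewrite liftK mnmE.
  have : q`_(m0 ord0) = 0 by rewrite q0 coef0.
  rewrite /q coef_sum => <-.
  rewrite /c raddf_sum /= big_mkcond /=; apply: eq_bigr => m _.
  rewrite coefZ coefXn eq_sym.
  by case: eqP => _; rewrite ?mulr0 ?mulr1 ?mevalZ.
have := congr1 (mcoeff (tl m0)) c0.
(* Only [m0] contributes: a monomial is determined by its first exponent and its tail. *)
rewrite mcoeff0 /c raddf_sum /= big_mkcond (bigD1_seq m0) ?msupp_uniq//= eqxx.
rewrite mcoeffZ mcoeffX eqxx mulr1 big1 ?addr0.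
  by move=> /eqP; rewrite mcoeff_eq0 m0p.
move=> m mm0; case: eqP => // m0E; rewrite mcoeffZ mcoeffX.
case: eqP => [/mnmP tlE|]; last by rewrite mulr0.
case/eqP: mm0; apply/mnmP => i; case: (unliftP ord0 i) => [j ->|-> //].
by have := tlE j; rewrite !mnmE.
Qed.

Lemma horner_mmap_line (C : comNzRingType) (d : nat) (p : mpoly d C)
    (a b : 'I_d -> C) (t : C) :
  (mmap polyC (fun i => (a i)%:P + b i *: 'X) p).[t] =
    meval (fun i => a i + b i * t) p.
Proof.
rewrite mevalE /mmap horner_sum; apply: eq_bigr => m _.
rewrite hornerM hornerC /mmap1 horner_prod; congr (_ * _).
by apply: eq_bigr => i _; rewrite horner_exp !hornerE.
Qed.

Lemma Re_near_gt0 (C : numClosedFieldType) (a b : C) :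
  0 < 'Re a -> \forall t \near 0^'+, 0 < 'Re (a + b * t).
Proof.
move=> a_gt0.
have := @horner_cvg_at_right C (a%:P + b *: 'X).
rewrite !hornerE => /cvgr_dist_lt/(_ _ a_gt0); apply: filterS => t.
rewrite !hornerE opprD addNKr normrN => bt.
rewrite raddfD /=.
have := le_lt_trans (leif_normC_Re_Creal (b * t)).1 bt.
by rewrite real_ltr_norml ?Creal_Re// => /andP[+ _]; rewrite -subr_gt0 opprK addrC.
Qed.

(* A nonconstant A / B takes, near a point x with B(x) <> 0, the form
   A(x) / B(x) + s^m (w + o(1)) with m >= 1 and w <> 0 along some complex line
   through x; choosing s = t u with u^m = conj w makes its real part nonzero. *)
Lemma ratio_const_of_Re_eq0 (C : numClosedFieldType) (d : nat) (A B : mpoly d C)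
    (s : C) :
  s != 0 -> B != 0 ->
  (forall x : 'rV[C]_d, (forall i, 0 < 'Re (x 0 i)) -> meval (x 0) B != 0 ->
     'Re (meval (x 0) A / (s * meval (x 0) B)) = 0) ->
  exists c, 'Re c = 0 /\ A = (c * s) *: B.
Proof.
move=> s0 B0 ReAsB.
have {ReAsB} ReAB (x : 'I_d -> C) : (forall i, 0 < 'Re (x i)) ->
    meval x (s *: B) != 0 -> 'Re (meval x A / meval x (s *: B)) = 0.
  have rowE q : meval x q = meval ((\row_i x i : 'rV_d) 0) q.
    by apply: meval_eq => i; rewrite mxE.
  move=> x_gt0; rewrite mevalZ mulf_eq0 negb_or => /andP[_].
  by rewrite (rowE A) (rowE B); apply: ReAsB => i; rewrite mxE.
suff [c [Rec AE]] : exists c, 'Re c = 0 /\ A = c *: (s *: B).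
  by exists c; rewrite -scalerA.
have {s0 B0} : s *: B != 0 by rewrite scaler_eq0 negb_or s0.
move: (s *: B) ReAB => {s}B ReAB B0.
have [x [x_gt0 Bx]] : exists x : 'I_d -> C, (forall i, 0 < x i) /\ meval x B != 0.
  apply: contrapT => nx; case/eqP: B0; apply: meval_pos_eq0 => x x_gt0.
  by apply/eqP/contraT => Bx; case: nx; exists x.
have Rex i : 0 < 'Re (x i) by rewrite (Creal_ReP _ _)// gtr0_real.
pose c := meval x A / meval x B.
have Rec : 'Re c = 0 by exact: ReAB.
exists c; split => //; apply/eqP; rewrite -subr_eq0; apply/eqP.
(* A - c B is tested at each positive y along the complex line having x at parameter 0 and y at
   parameter 1. *)
apply: meval_pos_eq0 => y y_gt0.
pose line p : {poly C} := mmap polyC (fun i => (x i)%:P + (y i - x i) *: 'X) p.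
have lineE p t : (line p).[t] = meval (fun i => x i + (y i - x i) * t) p.
  exact: horner_mmap_line.
have line0 p : (line p).[0] = meval x p.
  by rewrite lineE; apply: meval_eq => i; rewrite mulr0 addr0.
have line1 p : (line p).[1] = meval y p.
  by rewrite lineE; apply: meval_eq => i; rewrite mulr1 addrC subrK.
set E := A - c *: B; rewrite -line1.
have e0 : (line E).[0] = 0.
  by rewrite line0 mevalB mevalZ /c divfK// subrr.
suff -> : line E = 0 by rewrite horner0.
apply/eqP/contraT => eN0.
(* The root 0 is factored out: [line E] is [e1] times the m-th power of the variable, with e1(0)
   nonzero. Since E(x) = 0, m is positive and an m-th root makes sense. *)
have [m [e1 e1N0 eE]] := multiplicity_XsubC (line E) 0.
rewrite eN0 /= in e1N0; rewrite subr0 in eE.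
have m_gt0 : (0 < m)%N.
  case: m eE => // eE; move: e0 e1N0; rewrite eE expr0 mulr1.
  by rewrite /root => ->; rewrite eqxx.
pose w := e1.[0] / (line B).[0].
have w0 : w != 0 by rewrite mulf_neq0// invr_eq0 line0.
pose u := m.-root (w^*).
have um : u ^+ m = w^* by rewrite rootCK.
pose sc (q : {poly C}) := q \Po (u *: 'X).
have scE q t : (sc q).[t] = q.[u * t] by rewrite horner_comp !hornerE.
have cvgu q : q.[u * t] @[t --> 0^'+] --> q.[0].
  have := @horner_cvg_at_right C (sc q); rewrite scE mulr0.
  rewrite (_ : horner (sc q) = fun t => q.[u * t]) //.
  by apply/funext => t; rewrite scE.
have cw : - (u ^+ m * (e1.[u * t] / (line B).[u * t])) @[t --> 0^'+] -->
    - (u ^+ m * w).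
  apply: cvgN; apply: cvgM; first exact: cvg_cst.
  by apply: cvgM => //; apply: cvgV => //; rewrite line0.
(* For small t > 0, E / B = A / B - c has zero real part at parameter u t. Dividing by t^m > 0
   passes this to the limit in [cw], whose real part is -|w|^2 < 0: a contradiction. *)
have : 0 <= 'Re (- (u ^+ m * w)).
  apply: Re_lim_ge0 cw _.
  have tpos : \forall t \near (0 : C)^'+, 0 < t by exact: withinT.
  have Rpos : \forall t \near (0 : C)^'+,
      forall i, 0 < 'Re (x i + (y i - x i) * u * t).
    by apply: filter_forall => i; exact: Re_near_gt0.
  have Bne : \forall t \near (0 : C)^'+, (line B).[u * t] != 0.
    by apply: (cvgr_neq0 _ (cvgu _)); rewrite line0.
  near=> t.
  have t_gt0 : 0 < t by near: t.
  have Rt : forall i, 0 < 'Re (x i + (y i - x i) * u * t) by near: t.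
  have Bt : (line B).[u * t] != 0 by near: t.
  have : 'Re ((line E).[u * t] / (line B).[u * t]) = 0.
    rewrite !lineE mevalB mevalZ mulrBl.
    rewrite lineE in Bt.
    rewrite mulfK// raddfB /= Rec subr0 ReAB// => i.
    by rewrite mulrA.
  rewrite eE hornerM horner_exp hornerX exprMn.
  rewrite (_ : _ / _ = t ^+ m * (u ^+ m * (e1.[u * t] / (line B).[u * t]))).
    rewrite ReMl ?rpredX ?gtr0_real// => /eqP.
    rewrite mulf_eq0 expf_eq0 gt_eqF// andbF /= raddfN /= => /eqP ->.
    by rewrite oppr0.
  by ring.
rewrite um mulrC -normCK raddfN /= oppr_ge0 (Creal_ReP _ _) ?rpredX ?normr_real//.
by rewrite lt_geF ?exprn_gt0 ?normr_gt0.
Unshelve. all: by end_near.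
Qed.

(** * Homogeneous components *)

Lemma pihomog_ge_msize (C : nzRingType) (d k : nat) (q : mpoly d C) :
  (msize q <= k)%N -> pihomog mdeg k q = 0.
Proof.
move=> qk; rewrite pihomogE big_seq_cond big_pred0// => m.
apply/negP => /andP[/msize_mdeg_lt mq /eqP mk].
by move: mq; rewrite ltnNge mk qk.
Qed.

Lemma meval_pihomogZ (C : comNzRingType) (d k : nat) (q : mpoly d C)
    (x : 'I_d -> C) (t : C) :
  meval (fun i => t * x i) (pihomog mdeg k q) =
    t ^+ k * meval x (pihomog mdeg k q).
Proof.
rewrite pihomogE !raddf_sum /= mulr_sumr; apply: eq_bigr => m /eqP <-.
rewrite !mevalZ !mevalX mulrCA; congr (_ * _).
rewrite mdegE -prodrXr -big_split /=.
by apply: eq_bigr => i _; rewrite exprMn.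
Qed.

(** * Prolonging segments in a face *)

(** A segment of S with f in its interior also contains points slightly beyond f, seen from g. If f
    is extreme, g = f and any e works. *)
Lemma face_extension (K : numDomainType) (V : lmodType K) (S : set V) (f g : V) :
  face S f g -> [/\ S f, S g & exists2 e : K, 0 < e & S (f - e *: (g - f))].
Proof.
case=> [[[Sf _] ->]|[a [b [[_ abS [t /= /andP[t0 t1] <-]] [s /= /andP[s0 s1] <-]]]]].
  by split => //; exists 1; rewrite // subrr scaler0 subr0.
have segE r : (1 - r) *: a + r *: b = a + r *: (b - a).
  by rewrite scalerBl scale1r scalerBr addrA addrAC.
have inS r : 0 <= r -> 0 <= 1 - r -> S ((1 - r) *: a + r *: b).
  by rewrite subr_ge0 => r0 r1; apply: abS; exists r => //=; rewrite r0.
have [t1' s1'] : 0 < 1 - t /\ 0 <= 1 - s by rewrite subr_gt0 subr_ge0.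
have [t0w t1w] : 0 <= t /\ 0 <= 1 - t by rewrite !ltW.
split; [by apply: inS; rewrite ltW|by apply: inS|].
(* The new point has parameter r = t - e (s - t). With e = t (1 - t), r = t (1 - (1 - t)(s - t)) and
   1 - r = (1 - t)(1 + t (s - t)), both nonnegative since |s - t| <= 1. *)
exists (t * (1 - t)); first by rewrite mulr_gt0.
set r := t - t * (1 - t) * (s - t).
suff -> : (1 - t) *: a + t *: b - (t * (1 - t)) *:
    ((1 - s) *: a + s *: b - ((1 - t) *: a + t *: b)) = (1 - r) *: a + r *: b.
  apply: inS.
  - have -> : r = t * ((1 - s) + t * (1 - t) + t * s) by rewrite /r; ring.
    by rewrite mulr_ge0// addr_ge0 ?mulr_ge0// addr_ge0// mulr_ge0.
  - have -> : 1 - r = (1 - t) * ((1 - t) * (1 + t) + t * s) by rewrite /r; ring.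
    by rewrite mulr_ge0// addr_ge0 ?mulr_ge0// addr_ge0.
rewrite !segE.
by rewrite opprD addrACA subrr add0r -scalerBl scalerA -addrA -scalerBl.
Qed.

(** * Rays 1 - t zeta in the polydisc, and expansions along them *)

(** 1 - |1 - t z|^2 = t (2 Re z - t |z|^2). *)
Lemma norm_1subMt_near (C : numClosedFieldType) (z : C) :
  0 < 'Re z -> \forall t \near 0^'+, `|1 - t * z| < 1.
Proof.
move=> z0.
have tpos : \forall t \near (0 : C)^'+, 0 < t by exact: withinT.
have a0 : 0 < 'Re ('Re z *+ 2).
  by rewrite (Creal_ReP _ _) ?rpredMn ?Creal_Re// pmulrn_lgt0.
apply: filterS2 tpos (Re_near_gt0 (- `|z| ^+ 2) a0) => t t0.
have tr := gtr0_real t0.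
rewrite (Creal_ReP _ _); last first.
  by rewrite rpredD ?rpredM ?rpredN ?rpredX ?normr_real ?rpredMn ?Creal_Re.
move=> h; rewrite -(@ltr_pXn2r _ 2) ?nnegrE// expr1n normCK.
rewrite rmorphB rmorph1 rmorphM /= (CrealP tr) -subr_gt0.
rewrite (_ : _ - _ = t * ('Re z *+ 2 + - `|z| ^+ 2 * t)) ?mulr_gt0//.
rewrite ReE normCK -mulr_natr divfK ?pnatr_eq0//; ring.
Qed.

(** The region is invariant under positive scaling, so c need only bound the ratios |zeta_i| / Re
    zeta_j; the product of the sums [S] and [T] bounds them all. *)
Lemma ray_nontangential (R : realType) (d : nat) (zeta : 'rV[Cplx R]_d) :
  (forall i, 0 < 'Re (zeta 0 i)) ->
  exists c : R, forall t : Cplx R, 0 < t -> nontangential_region c (t *: zeta).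
Proof.
move=> z0.
pose S := \sum_i `|zeta 0 i|; pose T := \sum_i ('Re (zeta 0 i))^-1.
have S0 : 0 <= S by rewrite sumr_ge0.
have T0 : 0 <= T by rewrite sumr_ge0// => i _; rewrite invr_ge0 ltW.
exists (complex.Re (S * T)) => t t0.
have tr := gtr0_real t0.
split=> [i|i j]; rewrite !mxE ?ReMl ?mulr_gt0//.
rewrite RRe_real ?ger0_real ?mulr_ge0//.
rewrite normrM gtr0_norm// mulrCA ler_pM2l// -mulrA.
apply: (@le_trans _ _ (S * 1)).
  by rewrite mulr1 /S (bigD1 i)//= lerDl sumr_ge0.
apply: ler_wpM2l => //.
rewrite -ler_pdivrMr// mul1r /T (bigD1 j)//= lerDl sumr_ge0// => k _.
by rewrite invr_ge0 ltW.
Qed.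

Lemma nontangential_limit_ray (R : realType) (d : nat)
    (F : 'rV[Cplx R]_d -> Cplx R) (l : Cplx R) (zeta : 'rV[Cplx R]_d) :
  nontangential_limit_at1 F l -> (forall i, 0 < 'Re (zeta 0 i)) ->
  F (const_mx 1 - t *: zeta) @[t --> 0^'+] --> l.
Proof.
move=> Fl /ray_nontangential[c zc].
have tz : t *: zeta @[t --> (0 : Cplx R)^'+] --> (0 : 'rV[Cplx R]_d).
  rewrite -(scale0r zeta); apply: cvgZr_tmp; exact: cvg_within.
apply: cvg_trans (Fl c).
move=> A /= /tz /= hA.
have tpos : \forall t \near (0 : Cplx R)^'+, 0 < t by exact: withinT.
by apply: filterS2 tpos hA => t t0 /=; apply; exact: zc.
Qed.

(* [homog_at1] over an arbitrary field; at Cplx R the two are convertible. *)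
Definition homog_part1 (C : numClosedFieldType) (d k : nat) (q : mpoly d C) :
    mpoly d C :=
  pihomog mdeg k (comp_mpoly [tuple 1 - mpolyX C (mnm1 i) | i < d] q).

(** The polynomial t -> q(1 - t zeta), assembled from homogeneous parts so that its coefficients can
    be read off; the cut at [msize] drops only zero terms. *)
Definition ray (C : numClosedFieldType) (d : nat) (q : mpoly d C)
    (zeta : 'rV[C]_d) : {poly C} :=
  \poly_(j < msize (comp_mpoly [tuple 1 - mpolyX C (mnm1 i) | i < d] q))
    meval (zeta 0) (homog_part1 j q).

Lemma coef_ray (C : numClosedFieldType) (d : nat) (q : mpoly d C)
    (zeta : 'rV[C]_d) (j : nat) :
  (ray q zeta)`_j = meval (zeta 0) (homog_part1 j q).
Proof.
rewrite coef_poly; case: ltnP => // /pihomog_ge_msize pj.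
by rewrite /homog_part1 pj meval0.
Qed.

Lemma horner_ray (C : numClosedFieldType) (d : nat) (q : mpoly d C)
    (zeta : 'rV[C]_d) (t : C) :
  (ray q zeta).[t] = meval ((const_mx 1 - t *: zeta) 0) q.
Proof.
pose s := comp_mpoly [tuple 1 - mpolyX C (mnm1 i) | i < d] q.
transitivity (meval (fun i => t * zeta 0 i) s).
  rewrite horner_poly (pihomog_partitionE (leqnn (mmeasure mdeg s))).
  rewrite raddf_sum /=; apply: eq_bigr => j _.
  by rewrite meval_pihomogZ mulrC.
rewrite /s comp_mpoly_meval; apply: meval_eq => i.
by rewrite tnth_mktuple mevalB meval1 mevalXU !mxE.
Qed.

(** * Comparison of the bottom homogeneous terms *)

(** Projecting the equation to degree k kills its right side, which is homogeneous of degree M. *)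
Lemma homog_part1_eq0 (C : numClosedFieldType) (d k M : nat) (p v : mpoly d C)
    (c : C) :
  k != M -> homog_part1 k v = c *: homog_part1 M p ->
  homog_part1 k v = 0.
Proof.
move=> kM /(congr1 (pihomog mdeg k)); rewrite /homog_part1 pihomog_id => ->.
by rewrite linearZ /= (pihomog_ne0 _ (pihomogP _ _ _)) ?scaler0// eq_sym.
Qed.

Lemma homog_part1_proportional (C : numClosedFieldType) (d M : nat)
    (p v : mpoly d C) (F : 'rV[C]_d -> C) (l e : C) :
  (forall j, (j < M)%N -> homog_part1 j p = 0) -> homog_part1 M p != 0 ->
  `|l| = 1 -> l != 1 -> 0 < e ->
  (forall zeta : 'rV[C]_d, (forall i, 0 < 'Re (zeta 0 i)) ->
     F (const_mx 1 - t *: zeta) @[t --> 0^'+] --> l) ->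
  (forall zeta : 'rV[C]_d, (forall i, 0 < 'Re (zeta 0 i)) ->
     \forall t \near 0^'+,
       let z := const_mx 1 - t *: zeta in
       let f := (1 + F z) / (1 - F z) in
       let h := meval (z 0) v *+ 2 / (meval (z 0) p * (1 - F z)) in
       0 < 'Re (f + h) /\ 0 < 'Re (f - e * h)) ->
  exists c, 'Re c = 0 /\
    homog_part1 M v = (c * (1 - l)) *: homog_part1 M p.
Proof.
move=> p_low pM l1 lN1 e0 Fl fh.
have lN0 : 1 - l != 0 by rewrite subr_eq0 eq_sym.
have key k : (k <= M)%N -> (forall j, (j < k)%N -> homog_part1 j v = 0) ->
    exists c, 'Re c = 0 /\
      homog_part1 k v = (c * (1 - l)) *: homog_part1 M p.
  move=> kM v_low; apply: ratio_const_of_Re_eq0 => // zeta z_gt0 pMz.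
  rewrite -!coef_ray.
  apply: (@Re_ray_limit_eq0 _ _ _ (fun t => F (const_mx 1 - t *: zeta)) _ e) => //.
  - by move=> j jM; rewrite coef_ray p_low// meval0.
  - by rewrite coef_ray.
  - by move=> j jk; rewrite coef_ray v_low// meval0.
  - exact: Fl.
  - by apply: filterS (fh _ z_gt0) => t; rewrite !horner_ray.
(* [key] serves twice: below M, by strong induction, it forces the terms of v to vanish; at M it is
   the conclusion. *)
apply: (key M) => // k; elim/ltn_ind: k => k ih kM.
have [|c [_ cE]] := key k (ltnW kM).
  by move=> j jk; apply: ih => //; exact: ltn_trans kM.
by apply: homog_part1_eq0 cE; rewrite ltn_eqF.
Qed.

(** * The constant mu, and the passage from the face to the rays *)

(** 1 - mu^2 = mu (mu^-1 - mu), where mu^-1 - mu = conj mu - mu is imaginary, so its product with c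
    is real. *)
Lemma imaginary_mulB_sqr (R : realType) (mu c : Cplx R) :
  `|mu| = 1 -> 'Re c = 0 -> exists r : R, c * (1 - mu ^+ 2) = (r%:C)%C * mu.
Proof.
move=> mu1 c0.
have mu0 : mu != 0 by rewrite -normr_eq0 mu1 oner_neq0.
have muc : mu^* = mu^-1 by rewrite invC_norm mu1 expr1n invr1 mul1r.
have cc : c^* = - c.
  apply/eqP; rewrite -addr_eq0 addrC; apply/eqP.
  by rewrite -[LHS](@divfK _ 2) ?pnatr_eq0// -ReE c0 mul0r.
have r_real : c * (mu^-1 - mu) \is Num.real.
  apply/CrealP; rewrite rmorphM rmorphB fmorphV /= muc invrK cc; ring.
exists (complex.Re (c * (mu^-1 - mu))); rewrite RRe_real//.
by field.
Qed.

Lemma polydisc_ray_near (R : realType) (d : nat) (zeta : 'rV[Cplx R]_d) :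
  (forall i, 0 < 'Re (zeta 0 i)) ->
  \forall t \near 0^'+, polydisc (const_mx 1 - t *: zeta).
Proof.
move=> z0; have : \forall t \near (0 : Cplx R)^'+, forall i, `|1 - t * zeta 0 i| < 1.
  by apply: filter_forall => i; exact: norm_1subMt_near.
by apply: filterS => t tz i; rewrite !mxE.
Qed.

Unset Implicit Arguments.
Set Strict Implicit.

Theorem theorem2p2 (R : realType) (d : nat) (n : multinom d)
    (p v : mpoly d (Cplx R)) (M : nat) (mu : Cplx R) :
  let pt := reflection n p in
  let F := fun z : 'rV[Cplx R]_d => peval pt z / peval p z in
  let f := on_polydisc
             (fun z => peval (p + pt) z / peval (p - pt) z) in
  let g := on_polydisc
             (fun z => peval (p + pt + v *+ 2) z / peval (p - pt) z) in
  (0 < d)%N ->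
  multidegree_le n p ->
  zero_free_on_polydisc p ->
  no_nonconstant_common_factor p pt ->
  peval pt 0 = 0 ->
  multidegree_le n v ->
  v = reflection n v ->
  peval v 0 = 0 ->
  (exists a : R, [/\ 0 < a,
     zero_free_on_polydisc (p + v) &
     zero_free_on_polydisc (p - (a%:C)%C *: v)]) ->
  face (@PRP R d) f g ->
  vanishes_at1_to_order p M ->
  `|mu| = 1 ->
  nontangential_limit_at1 F (mu ^+ 2) ->
  mu ^+ 2 <> 1 ->
  exists r : R, homog_at1 M v = ((r%:C)%C * mu) *: homog_at1 M p.
Proof.
move=> pt F f g _ _ p_zf _ _ _ _ _ _ fg [p_low pM] mu1 Flim mu2N1.
have [[_ _ f_pos _] [_ _ g_pos _] [e e0 [_ _ fe_pos _]]] :=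
  face_extension fg.
have l1 : `|mu ^+ 2| = 1 by rewrite normrX mu1 expr1n.
have lN1 : mu ^+ 2 != 1 by exact/eqP.
have [|||c [c0 cE]] :=
  @homog_part1_proportional _ _ _ _ v F _ _ p_low _ l1 lN1 e0.
- exact/eqP.
- by move=> zeta; exact: nontangential_limit_ray.
- move=> zeta z_gt0.
  apply: filterS (polydisc_ray_near z_gt0) => t tD.
  move: (const_mx 1 - t *: zeta) tD => z zD.
  have /eqP pz := p_zf _ zD.
  have fE : f z = (peval p z + peval pt z) / (peval p z - peval pt z).
    by rewrite /f /on_polydisc patchE mem_set// /peval mevalD mevalB.
  have gE : g z = (peval p z + peval pt z + peval v z *+ 2) /
      (peval p z - peval pt z).
    by rewrite /g /on_polydisc patchE mem_set// /peval mevalB 2!mevalD mevalMn.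
  have dz : peval p z - peval pt z != 0.
    (* Division by zero yields 0, so a zero of the denominator would give f z = 0, against Re f >
       0. *)
    apply: contraTneq (f_pos _ zD) => dz.
    by rewrite fE dz invr0 mulr0 raddf0 ltxx.
  have fF : (1 + F z) / (1 - F z) = f z.
    by rewrite fE /F; field; rewrite pz dz.
  (* Thus h = g - f, and the two functions needed on the ray are g and the prolonged point f - e (g
     - f). *)
  have hF : peval v z *+ 2 / (peval p z * (1 - F z)) = g z - f z.
    by rewrite fE gE /F; field; rewrite pz dz.
  rewrite fF hF addrC subrK; split; first exact: g_pos.
  exact: fe_pos.
have [r rE] := imaginary_mulB_sqr mu1 c0.
by exists r; rewrite -rE.
Qed.
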